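(* Let $F\in\mathcal{F}$, let $X_1, X_2, \ldots$ be independent and identically distributed real random variables on a probability space $(\Omega,\mathcal{A},P)$ with distribution function $F$, and for each $n\ge 1$ let $F_n(x) = \frac{1}{n}\sum_{i=1}^n \mathbf{1}_{(-\infty,x]}(X_i)$ ($x\in\mathbb{R}$). Then for each integer $q\ge 1$, $D_q(F_n,F)$ converges completely to $0$ as $n\to\infty$, i.e., $$\sum_{n=1}^\infty P\bigl(D_q(F_n,F)>\epsilon\bigr)<\infty$$ for any $\epsilon>0$.
   Context: $\mathcal{F}$ denotes the set of distribution functions on $\mathbb{R}$: functions $F:\mathbb{R}\to\mathbb{R}$ that are nondecreasing, right-continuous, and satisfy $F(-\infty):=\lim_{x\to-\infty}F(x)=0$ and $F(\infty):=\lim_{x\to\infty}F(x)=1$. For $-\infty\le x\le y\le\infty$ write $F|_x^y = F(y)-F(x)$. For an integer $q\ge1$ let $\mathbb{R}^q_{\le}=\{(v_1,\ldots,v_q)\in\mathbb{R}^q: v_1\le\cdots\le v_q\}$. For $F,G\in\mathcal{F}$ and $\boldsymbol{v}=(v_1,\ldots,v_q)\in\mathbb{R}^q_{\le}$, with the convention $v_0=-\infty$ and $v_{q+1}=\infty$, put $$r_{F,G}(\boldsymbol{v})=\sum_{i=0}^q \min\bigl\{F|_{v_i}^{v_{i+1}},\,G|_{v_i}^{v_{i+1}}\bigr\},\qquad D_q(F,G)=1-\inf_{\boldsymbol{v}\in\mathbb{R}^q_{\le}} r_{F,G}(\boldsymbol{v}).$$ $\mathbf{1}_A$ denotes the indicator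 function of a set $A$. *)

(* Defs.v *)
From HB Require Import structures.
From mathcomp Require Import all_boot all_order all_algebra finmap.
From mathcomp Require Import all_classical all_reals all_analysis.

Set Implicit Arguments.
Unset Strict Implicit.
Unset Printing Implicit Defensive.

Import Order.TTheory GRing.Theory Num.Theory.
Import numFieldNormedType.Exports.

Local Open Scope classical_set_scope.
Local Open Scope ring_scope.

(* The class of distribution functions on R is [cumulativeBounded (0 : R) 1].
   The definitions below are stated for arbitrary functions R -> R, so that
   they apply directly to empirical distribution functions; they are only
   meaningful on distribution functions. *)

Definition ext_value (R : realType) (F : R -> R) (x : \bar R) : R :=
  match x with
  | r%:E => F r
  | +oo%E => lim (F @ +oo)
  | -oo%E => lim (F @ -oo)
  end.

Definition increment (R : realType) (F : R -> R) (x y : \bar R) : R :=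
  ext_value F y - ext_value F x.

(* v = (v_1, ..., v_q) is a tuple indexed from 0; [knot v i] is v_i in the
   1-based numbering, with knot v 0 = -oo and knot v q.+1 = +oo. *)
Definition knot (R : realType) (q : nat) (v : q.-tuple R) (i : nat) : \bar R :=
  nth +oo%E (-oo%E :: [seq x%:E | x <- v]) i.

Definition rFG (R : realType) (F G : R -> R) (q : nat) (v : q.-tuple R) : R :=
  \sum_(0 <= i < q.+1)
    Num.min (increment F (knot v i) (knot v i.+1))
            (increment G (knot v i) (knot v i.+1)).

Definition Dq (R : realType) (q : nat) (F G : R -> R) : R :=
  1 - inf [set rFG F G v | v in [set v : q.-tuple R | sorted <=%R v]].

Definition mutually_independent d (T : measurableType d) (R : realType)
    (P : probability T R) (I : choiceType) (X : I -> {RV P >-> R}) : Prop :=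
  forall (J : {fset I}) (A : I -> set R),
    (forall i, i \in J -> measurable (A i)) ->
    P (\bigcap_(i in [set` J]) (X i @^-1` A i)) =
    (\prod_(i <- J) P (X i @^-1` A i))%E.

Definition identically_distributed d (T : measurableType d) (R : realType)
    (P : probability T R) (I : Type) (X : I -> {RV P >-> R}) : Prop :=
  forall (i j : I) (A : set R), measurable A ->
    distribution P (X i) A = distribution P (X j) A.

(* Sequences are indexed from 0: the sample of size n is X 0, ..., X n.-1.
   For n = 0 this is the zero function, not a distribution function. *)
Definition empirical_df d (T : measurableType d) (R : realType)
    (P : probability T R) (X : nat -> {RV P >-> R}) (n : nat) (w : T) : R -> R :=
  fun x => n%:R^-1 * \sum_(i < n) \1_(`]-oo, x] : set R) (X i w).

(* Main.v *)
Require Import Defs.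
From HB Require Import structures.
From mathcomp Require Import all_boot all_order all_algebra finmap.
From mathcomp Require Import all_classical all_reals all_analysis.
From mathcomp Require Import measurable_realfun ring lra.

Import Order.TTheory GRing.Theory Num.Theory.
Import numFieldNormedType.Exports.

Local Open Scope classical_set_scope.
Local Open Scope ring_scope.

(** For every partition of the line by knots, the increments of F sum to 1, so
    1 - r_{F_n,F} is a sum of q + 1 positive parts of differences of
    increments.  Each is at most twice sup |F_n - F|, hence
    D_q(F_n, F) <= 2 (q + 1) sup |F_n - F| ([Dq_le_uniform]), and it remains to
    prove the Glivenko-Cantelli theorem with summable probabilities.

    The supremum is controlled by finitely many events.  For a level c, the
    half-line [below_level F c] of points where F is still below c has
    probability at most c, and the half-line [above_level F c] of points lying
    to the right of some point where F has reached c has probability at most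
    1 - c.  When k / M <= F x < (k + 1) / M, the half-line ]-oo, x]
    is contained in the first set at level (k + 1) / M, and its complement in
    the second at level k / M.  So if none of these 2 (M + 1) sets is hit by
    the sample with a frequency exceeding its bound by delta, then
    |F_n - F| <= 1 / M + delta everywhere ([empirical_df_uniform_close]).
    When 0 < c < 1 the two sets are the open half-lines on either side of the
    c-quantile of F, so a mass at the quantile counts in neither and jumps of F
    are harmless.

    Each of these excesses has probability at most rho ^ n with rho < 1, by
    Chernoff's exponential bound ([chernoff_independent_count]).  Independence
    is a product rule for events, so the bound is obtained without integrals:
    the sample is split into the 2 ^ n patterns telling which observations hit
    the set, and the exponentially weighted sum over patterns factors.  The
    probabilities are thus dominated by a geometric series.

    The event D_q(F_n, F) > eps is an uncountable union over knot tuples.  Its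
    measurability comes from right-continuity: moving every knot to the next
    point of a fine grid changes r_{F_n,F} arbitrarily little, so knots on
    countably many grids suffice ([Dq_gtP]). *)

(** * Bounds for the measure of a union *)
Section UnionBounds.
Context d (T : measurableType d) (R : realType) (mu : {measure set T -> \bar R}).

Lemma measure_bigsetU_le (I : Type) (s : seq I) (Q : pred I) (A : I -> set T) :
  (forall i, measurable (A i)) ->
  (mu (\big[setU/set0]_(i <- s | Q i) A i) <= \sum_(i <- s | Q i) mu (A i))%E.
Proof.
move=> mA; elim: s => [|i s IH]; first by rewrite !big_nil measure0.
rewrite !big_cons; case: ifP => // _; rewrite (le_trans (measureU2 _ _ _))//.
  by elim/big_ind: _ => //; exact: measurableU.
exact: leeD2l.
Qed.

(** In a chain, a finite union is one of its members, so continuity from below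
    transfers a common bound to the whole union. *)
Lemma measure_bigcup_chain (A : nat -> set T) (c : \bar R) :
  (forall i, measurable (A i)) ->
  (forall i j, A i `<=` A j \/ A j `<=` A i) ->
  (0 <= c)%E -> (forall i, (mu (A i) <= c)%E) ->
  (mu (\bigcup_i A i) <= c)%E.
Proof.
move=> mA chain c0 leA.
pose B n := \big[setU/set0]_(i < n) A i.
have BE : \bigcup_n B n = \bigcup_i A i.
  apply/seteqP; split=> [x [n _]|x [n _ Anx]].
    by rewrite /B -bigcup_mkord => -[i _ Aix]; exists i.
  by exists n.+1 => //; rewrite /B big_ord_recr/=; right.
have mB n : measurable (B n) by exact: bigsetU_measurable.
have Bcases n : B n = set0 \/ exists i, B n = A i.
  elim: n => [|n [B0|[i Bi]]]; first by left; rewrite /B big_ord0.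
    by right; exists n; rewrite /B big_ord_recr/= -/(B n) B0 set0U.
  right; rewrite /B big_ord_recr/= -/(B n) Bi.
  by case: (chain i n) => /setUidPr e; [exists n|exists i; rewrite setUC].
have ndB : nondecreasing_seq B
  by move=> m n mn; apply/subsetPset; exact: subset_bigsetU.
rewrite -BE.
have cB := nondecreasing_cvg_mu (mu := mu) mB (bigcup_measurable (fun n _ => mB n)) ndB.
rewrite -(cvg_lim _ cB)//; apply: lime_le; first by apply/cvg_ex; eexists; exact: cB.
apply: nearW => n /=.
by case: (Bcases n) => [->|[i ->]]; rewrite ?measure0.
Qed.

End UnionBounds.

(** * Chernoff's bound from the product rule for events *)
Section Chernoff.
Context d (T : measurableType d) (R : realType) (P : probability T R).
Context (X : nat -> {RV P >-> R}) (X_indep : mutually_independent X).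

(** The product rule over the subfamily {0, ..., n - 1}, in terms of ordinals,
    which is the form needed to factor sums over patterns. *)
Lemma independent_prod_ord n (B : 'I_n -> set R) :
  (forall i, measurable (B i)) ->
  P [set w | forall i : 'I_n, B i (X i w)] =
  (\prod_(i < n) P (X i @^-1` B i))%E.
Proof.
move=> mB.
pose C (k : nat) : set R := oapp B setT (insub k).
have CE (i : 'I_n) : C i = B i by rewrite /C valK.
have mC k : measurable (C k) by rewrite /C; case: insub => //=.
pose J := [fset k in iota 0 n]%fset.
have JE k : (k \in J) = (k < n)%N by rewrite /J inE mem_iota.
have -> : [set w | forall i : 'I_n, B i (X i w)] =
          \bigcap_(k in [set` J]) (X k @^-1` C k).
  apply/seteqP; split=> w /= Hw.
    move=> k /=; rewrite JE => kn.
    by have := Hw (Ordinal kn); rewrite -CE.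
  by move=> i; rewrite -CE; apply: Hw => /=; rewrite JE.
rewrite X_indep// [LHS](perm_big (iota 0 n)) /=; last first.
  apply: uniq_perm; rewrite ?fset_uniq ?iota_uniq// => k.
  by rewrite JE mem_iota.
rewrite -[X in iota 0 X]subn0 -/(index_iota 0 n) big_mkord.
by apply: eq_bigr => i _; rewrite CE.
Qed.

(** The exponential moment of one centred indicator.  With l = delta / 4 <= 1 / 4,
    exp l <= 1 + l + 2 l^2 follows from exp (- l) >= 1 - l, so the moment is at
    most exp (p0 (l + 2 l^2) - l (p + delta)) <= exp (2 l^2 - l delta), which is
    the right-hand side. *)
Lemma chernoff_factor (p0 p delta : R) :
  0 <= p0 -> p0 <= 1 -> p0 <= p -> 0 < delta -> delta <= 1 ->
  p0 * expR (delta / 4 * (1 - (p + delta))) +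
  (1 - p0) * expR (delta / 4 * (0 - (p + delta))) <= expR (- (delta ^+ 2 / 8)).
Proof.
move=> p00 p01 p0p d0 d1; set l := delta / 4.
have l0 : 0 < l by rewrite /l; lra.
have l1 : l <= 4^-1 by rewrite /l; lra.
have dl : delta = 4 * l by rewrite /l; lra.
have expl : expR l <= 1 + l + 2 * l ^+ 2.
  have elN : 1 - l <= (expR l)^-1 by rewrite -expRN; exact: expR_ge1Dx.
  have el0 := expR_gt0 l.
  have : (1 - l) * expR l <= 1 by rewrite -ler_pdivlMr// div1r.
  nra.
have -> : l * (1 - (p + delta)) = l + l * (0 - (p + delta)) by ring.
rewrite expRD; set e := expR (l * (0 - _)).
have e0 : 0 < e by exact: expR_gt0.
have -> : p0 * (expR l * e) + (1 - p0) * e = (1 + p0 * (expR l - 1)) * e by ring.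
apply: (@le_trans _ _ (expR (p0 * (l + 2 * l ^+ 2)) * e)).
  rewrite ler_pM2r//; apply: le_trans (expR_ge1Dx _).
  by rewrite lerD2l ler_wpM2l//; lra.
rewrite /e -expRD ler_expR dl; nra.
Qed.

(** Markov's inequality for the exponential moment, carried out on patterns: a
    pattern f records which of the first n observations fall in A, its
    probability is a product by independence, and on large patterns the weight
    exp (l (sum of the c (f i))) is at least 1.  Only an upper bound p common to
    all hitting probabilities is assumed, since a larger p makes the event
    smaller. *)
Lemma chernoff_independent_count (A : set R) (p delta : R) n :
  measurable A -> 0 < delta -> delta <= 1 ->
  (forall i, (P (X i @^-1` A) <= p%:E)%E) ->
  (P [set w | (n%:R * (p + delta) <= \sum_(i < n) \1_A (X i w))%R] <=
   (expR (- (delta ^+ 2 / 8)) ^+ n)%:E)%E.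
Proof.

move=> mA d0 d1 leA.
pose p_ (i : nat) := fine (P (X i @^-1` A)).
have mX i (B : set R) : measurable B -> measurable (X i @^-1` B).
  by move=> mB; rewrite -[X in measurable X]setTI; exact: measurable_funPT.
have pE i : P (X i @^-1` A) = (p_ i)%:E by rewrite fineK// fin_num_measure//; exact: mX.
have p0 i : 0 <= p_ i by exact: fine_ge0.
have p1 i : p_ i <= 1 by rewrite -lee_fin -pE probability_le1//; exact: mX.
have pp i : p_ i <= p by rewrite -lee_fin -pE.
pose B (b : bool) := if b then A else ~` A.
have mB b : measurable (B b) by case: b => //=; exact: measurableC.
pose a i b := if b then p_ i else 1 - p_ i.
have aE i b : P (X i @^-1` B b) = (a i b)%:E.
  case: b => //=; rewrite preimage_setC probability_setC ?pE//; exact: mX.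
have a0 i b : 0 <= a i b by case: b; rewrite /a//= subr_ge0.
pose E (f : {ffun 'I_n -> bool}) := [set w | forall i : 'I_n, B (f i) (X i w)].
have PE f : P (E f) = (\prod_(i < n) a i (f i))%:E.
  rewrite /E (independent_prod_ord n (fun i => B (f i)))// -prodEFin.
  by apply: eq_bigr => i _; rewrite aE.
have mE f : measurable (E f).
  have -> : E f = \bigcap_(i in [set: 'I_n]) (X i @^-1` B (f i)).
    by apply/seteqP; split=> w /= Hw i; [move=> _|]; exact: Hw.
  by apply: fin_bigcap_measurable => // i _; exact: mX.
pose c (b : bool) : R := b%:R - (p + delta).
pose large (f : {ffun 'I_n -> bool}) := 0 <= \sum_(i < n) c (f i).
apply: (@le_trans _ _ (P (\big[setU/set0]_(f | large f) E f))).
  apply: le_measure; rewrite ?inE.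
  - rewrite -[X in measurable X]setTI; apply: measurable_fun_le => //.
    apply: measurable_sum => i; apply: measurableT_comp => //.
  - by elim/big_ind: _ => // *; exact: measurableU.
  (* w lies in the event of its own pattern *)
  move=> w /= Hw; pose f := [ffun i : 'I_n => `[< A (X i w) >]].
  have fE (i : 'I_n) : \1_A (X i w) = (f i)%:R :> R.
    by rewrite ffunE indicE; congr (nat_of_bool _)%:R; apply/idP/asboolP; rewrite inE.
  rewrite -bigcup_seq_cond; exists f => /=.
    rewrite mem_index_enum/= /large /c sumrB sumr_const card_ord -mulr_natl subr_ge0.
    by under eq_bigr do rewrite -fE.
  move=> i; have [Ai|nAi] := asboolP (A (X i w)); rewrite /B ffunE.
    by rewrite asboolT.
  by rewrite asboolF.
apply: le_trans; first exact: measure_bigsetU_le.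
rewrite (eq_bigr (fun f : {ffun 'I_n -> bool} => (\prod_(i < n) a i (f i))%:E))
  => [|f _]; last exact: PE.
rewrite sumEFin lee_fin.
pose l := delta / 4.
have l0 : 0 <= l by rewrite /l; lra.
apply: (@le_trans _ _ (\sum_(f : {ffun 'I_n -> bool})
    \prod_(i < n) (a i (f i) * expR (l * c (f i))))).
  rewrite big_mkcond/=; apply: ler_sum => f _.
  rewrite big_split/= -expR_sum -mulr_sumr.
  have a_ge0 : 0 <= \prod_(i < n) a i (f i) by exact: prodr_ge0.
  case: ifPn => [lf|_]; last by rewrite mulr_ge0// expR_ge0.
  by rewrite ler_peMr// -expR0 ler_expR mulr_ge0.
(* the sum over all patterns of a product is a product of two-term sums *)
rewrite -(bigA_distr_bigA (fun (i : 'I_n) (b : bool) => a i b * expR (l * c b))).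
rewrite -[X in _ <= _ ^+ X]card_ord -prodr_const.
apply: ler_prod => i _; rewrite big_bool; apply/andP; split.
  by rewrite addr_ge0// mulr_ge0 ?expR_ge0 ?a0.
exact: chernoff_factor (p0 i) (p1 i) (pp i) d0 d1.
Qed.
End Chernoff.

(** * Strict rounding up to a grid *)
Section RoundingUp.
Context {R : realType}.

Definition grid_point (N : nat) (z : int) : R := z%:~R / N.+1%:R.

(** The floor plus one rather than the ceiling: the grid point must lie strictly
    to the right of x for a right limit to apply, even if x is on the grid. *)
Definition grid_above (N : nat) (x : R) : int := Num.floor (x * N.+1%:R) + 1.

Lemma grid_above_gt N x : x < grid_point N (grid_above N x).
Proof. by rewrite ltr_pdivlMr ?ltr0Sn// floorD1_gt. Qed.

Lemma grid_above_le N x : grid_point N (grid_above N x) <= x + N.+1%:R^-1.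
Proof.
rewrite ler_pdivrMr ?ltr0Sn// mulrDl mulVf ?pnatr_eq0// rmorphD/= lerD2r.
by have /andP[] := floor_itv (x * N.+1%:R).
Qed.

Lemma grid_above_homo N :
  {homo (fun x => grid_point N (grid_above N x)) : x y / x <= y}.
Proof.
move=> x y xy; rewrite ler_pM2r ?invr_gt0 ?ltr0Sn// ler_int lerD2r.
by rewrite le_floor// ler_wpM2r.
Qed.

Lemma cvg_grid_above x : grid_point N (grid_above N x) @[N --> \oo] --> x.
Proof.
apply: (@squeeze_cvgr _ _ _ _ (cst x) (fun N => x + N.+1%:R^-1)).
- by apply: nearW => N; rewrite (ltW (grid_above_gt _ _)) grid_above_le.
- exact: cvg_cst.
- rewrite -[X in _ --> X]addr0; apply: cvgD; first exact: cvg_cst.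
  exact: cvg_harmonic.
Qed.

End RoundingUp.

(** * Uniform distance and countable knots control the divergence *)
Section DqDeterministic.
Context {R : realType}.
Implicit Types F G : cumulativeBounded (0 : R) 1.

(** [er_map] fixes the infinite end knots, so moving the knots by f treats all
    indices alike. *)
Lemma knot_map q (f : R -> R) (v : q.-tuple R) i :
  knot (map_tuple f v) i = er_map f (knot v i).
Proof.
rewrite /knot /=.
have -> : -oo%E :: [seq x%:E | x <- [seq f x | x <- v]] =
          [seq er_map f x | x <- -oo%E :: [seq x%:E | x <- v]].
  by rewrite /= -!map_comp.
have [lt|ge] := ltnP i (size (-oo%E :: [seq x%:E | x <- v])).
  exact: nth_map.
by rewrite [RHS]/= !nth_default// size_map.
Qed.

(** An increment of a function changes by at most 2 eta when the function
    changes by at most eta, and min is 1-Lipschitz for the sup norm.  This single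
    estimate serves to compare r_{G,F} with r_{F,F} = 1, to bound r_{F,G} below,
    and to move the knots. *)
Lemma sum_min_increments_lipschitz n (a b a' b' : nat -> R) (eta : R) :
  (forall i, (i <= n)%N -> `|a i - a' i| <= eta) ->
  (forall i, (i <= n)%N -> `|b i - b' i| <= eta) ->
  `|\sum_(0 <= i < n) Num.min (a i.+1 - a i) (b i.+1 - b i) -
    \sum_(0 <= i < n) Num.min (a' i.+1 - a' i) (b' i.+1 - b' i)|
  <= n%:R * (2 * eta).
Proof.
move=> aa bb; rewrite -sumrB (le_trans (ler_norm_sum _ _ _))//.
rewrite mulr_natl -[X in _ *+ X]subn0 -sumr_const_nat; apply: ler_sum_nat => i /= ni.
have := aa i (ltnW ni); have := aa i.+1 ni; have := bb i (ltnW ni); have := bb i.+1 ni.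
rewrite !ler_norml => /andP[? ?] /andP[? ?] /andP[? ?] /andP[? ?].
case: (leP (a i.+1 - a i)) => ?; case: (leP (a' i.+1 - a' i)) => ?;
  apply/andP; split; lra.
Qed.

Lemma ext_valueNy F : ext_value F -oo = 0.
Proof. exact: cvg_lim (cumulativeNy F). Qed.

Lemma ext_valuey F : ext_value F +oo = 1.
Proof. exact: cvg_lim (cumulativey F). Qed.

Lemma cumulative_itv01 F x : 0 <= F x <= 1.
Proof.
have ndF := cumulative_is_nondecreasing F.
apply/andP; split.
  apply: (cvgr_to_le (cumulativeNy F)).
  by near=> y; apply: ndF; near: y; exact: nbhs_ninfty_le.
apply: (cvgr_to_ge (cumulativey F)).
by near=> y; apply: ndF; near: y; exact: nbhs_pinfty_ge.
Unshelve. all: by end_near. Qed.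

Lemma ext_value_itv01 F x : 0 <= ext_value F x <= 1.
Proof.
case: x => [r||]; first exact: cumulative_itv01.
- by rewrite ext_valuey ler01 lexx.
- by rewrite ext_valueNy ler01 lexx.
Qed.

Lemma rFG_self F q (v : q.-tuple R) : rFG F F v = 1.
Proof.
rewrite /rFG; under eq_bigr do rewrite minxx.
rewrite (telescope_sumr (fun i => ext_value F (knot v i)))//.
rewrite ext_valueNy /knot/= nth_default ?size_map ?size_tuple//.
by rewrite ext_valuey subr0.
Qed.

(** Comparing F and G with the constant 1 / 2 is crude, but any lower bound
    makes the infimum in D_q a greatest lower bound. *)
Lemma rFG_has_lbound F G q :
  has_lbound [set rFG F G v | v in [set v : q.-tuple R | sorted <=%R v]].
Proof.
exists (- q.+1%:R) => _ [v _ <-].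
have half (H : cumulativeBounded (0 : R) 1) x : `|ext_value H x - 2^-1| <= 2^-1 :> R.
  by have /andP[] := ext_value_itv01 H x; rewrite ler_norml => *; lra.
have := @sum_min_increments_lipschitz q.+1 (fun i => ext_value F (knot v i))
  (fun i => ext_value G (knot v i)) (cst 2^-1) (cst 2^-1) 2^-1
  (fun i _ => half F _) (fun i _ => half G _).
rewrite [X in _ - X]big1 => [|i _]; last by rewrite /= !subrr minxx.
by rewrite subr0 divff// mulr1 ler_norml => /andP[].
Qed.

(** The infimum is compared with r_{F,F} = 1: replacing the first F by G costs
    at most 2 eta for each of the q + 1 increments. *)
Lemma Dq_le_uniform F G q (eta : R) : (forall x, `|G x - F x| <= eta) ->
  Dq q G F <= q.+1%:R * (2 * eta).
Proof.
move=> GF; rewrite /Dq lerBlDr -lerBlDl; apply: lb_le_inf.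
  exists (rFG G F (nseq_tuple q 0)); exists (nseq_tuple q 0) => //=.
  by apply/(sortedP 0) => i; rewrite size_nseq => iq; rewrite !nth_nseq !if_same.
move=> _ [v _ <-].
have eta0 : 0 <= eta by rewrite (le_trans _ (GF 0)).
have GFx x : `|ext_value G x - ext_value F x| <= eta.
  case: x => [r||]; first exact: GF.
    by rewrite !ext_valuey subrr normr0.
  by rewrite !ext_valueNy subrr normr0.
have := @sum_min_increments_lipschitz q.+1 (fun i => ext_value G (knot v i))
  (fun i => ext_value F (knot v i)) (fun i => ext_value F (knot v i))
  (fun i => ext_value F (knot v i)) eta (fun i _ => GFx _)
  (fun i _ => _).
rewrite -/(rFG F F v) rFG_self ler_norml => /(_ _)/andP[|+ _].
  by move=> i; rewrite subrr normr0.
by rewrite -/(rFG G F v); lra.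
Qed.

Lemma cvg_ext_value_grid F x :
  ext_value F (er_map (fun y => grid_point N (grid_above N y)) x) @[N --> \oo]
    --> ext_value F x.
Proof.
case: x => [r||] /=; [|exact: cvg_cst..].
have /cvg_at_rightP := @cumulative_is_right_continuous _ _ _ F r; apply; split.
  by move=> N; exact: grid_above_gt.
exact: cvg_grid_above.
Qed.

(** Right-continuity at finitely many knots, with the tolerance eta at which
    the Lipschitz estimate costs half of the available gap. *)
Lemma rFG_grid_lt F G q (v : q.-tuple R) (c : R) : rFG F G v < c ->
  exists N, rFG F G (map_tuple (fun y => grid_point N (grid_above N y)) v) < c.
Proof.
move=> rc; pose eta := (c - rFG F G v) / (4 * q.+1%:R).
have q0 : 0 < q.+1%:R :> R by [].
have eta0 : 0 < eta by rewrite divr_gt0 ?subr_gt0// mulr_gt0.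
have near_knots (H : cumulativeBounded (0 : R) 1) : \forall N \near \oo, forall i : 'I_q.+2,
    `|ext_value H (knot (map_tuple (fun y => grid_point N (grid_above N y)) v) i) -
      ext_value H (knot v i)| <= eta.
  apply: filter_forall => i.
  have /cvgrPdist_le /(_ _ eta0) := @cvg_ext_value_grid H (knot v i).
  by apply: filterS => N; rewrite knot_map distrC.
have [N [HF HG]] := filter_ex (filterI (near_knots F) (near_knots G)).
exists N.
have := @sum_min_increments_lipschitz q.+1 _ _ _ _ _
  (fun i iq => HF (Ordinal (iq : (i < q.+2)%N)))
  (fun i iq => HG (Ordinal (iq : (i < q.+2)%N))).
rewrite -!/(rFG _ _ _) ler_norml => /andP[_].
have -> : q.+1%:R * (2 * eta) = (c - rFG F G v) / 2.
  by rewrite /eta; move: (q.+1%:R : R) q0 => k k0; field; rewrite gt_eqF.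
lra.
Qed.

(** Rounding up is monotone and therefore keeps the knots sorted, so the
    infimum over real knots drops below 1 - eps exactly when it does so over
    the countable set of grid tuples. *)
Lemma Dq_gtP F G q (eps : R) :
  eps < Dq q F G <->
  exists Nt : nat * q.-tuple int,
    sorted <=%R (map_tuple (grid_point Nt.1) Nt.2 : seq R) /\
    rFG F G (map_tuple (grid_point Nt.1) Nt.2) < 1 - eps.
Proof.
rewrite /Dq ltrBrDl -ltrBrDr; split.
  move=> /inf_lt[|_ [v /= sv <-] rc].
    exists (rFG F G (nseq_tuple q 0)); exists (nseq_tuple q 0) => //=.
    by apply/(sortedP 0) => i; rewrite size_nseq => iq; rewrite !nth_nseq !if_same.
  have [N rN] := rFG_grid_lt _ _ _ _ _ rc; exists (N, map_tuple (grid_above N) v).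
  have -> : map_tuple (grid_point N : int -> R) (map_tuple (grid_above N) v) =
      map_tuple (fun y => grid_point N (grid_above N y)) v.
    by apply: eq_from_tnth => i; rewrite !tnth_map.
  by split => //=; rewrite -map_comp; apply: homo_sorted sv; exact: grid_above_homo.
move=> [[N t] /= [st rt]]; apply: le_lt_trans rt.
by apply: ge_inf; [exact: rFG_has_lbound|exists (map_tuple (grid_point N) t)].
Qed.

End DqDeterministic.

(** * Empirical distribution functions *)
Section EmpiricalDF.
Context d (T : measurableType d) (R : realType) (P : probability T R).
Context (X : nat -> {RV P >-> R}).

Lemma empirical_dfE n w x :
  empirical_df X n w x = n%:R^-1 * \sum_(i < n) (X i w <= x)%R%:R.
Proof.
by congr (_ * _); apply: eq_bigr => i _; rewrite indicE mem_setE in_itv.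
Qed.

(** An empirical distribution function is a step function: along a filter that
    decides each comparison of x with an observation, it is eventually
    constant.  This covers right limits and both limits at infinity. *)
Lemma cvg_empirical_df n w (H : set_system R) {FH : Filter H} (b : 'I_n -> bool) :
  (forall i : 'I_n, \forall x \near H, (X i w <= x) = b i) ->
  empirical_df X n w @ H --> (n%:R^-1 * \sum_(i < n) (b i)%:R : R).
Proof.
move=> Hb; apply: cvg_near_cst; move: (filter_forall FH Hb); apply: filterS => x bx.
by rewrite empirical_dfE; congr (_ * _); apply: eq_bigr => i _; rewrite bx.
Qed.

Lemma empirical_df_nondecreasing n w :
  {homo empirical_df X n w : x y / x <= y}.
Proof.
move=> x y xy; rewrite !empirical_dfE ler_wpM2l// ?invr_ge0//.
apply: ler_sum => i _; rewrite ler_nat.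
by case: (leP (X i w) x) => // Xx; rewrite (le_trans Xx xy).
Qed.

Lemma empirical_df_right_continuous n w :
  right_continuous (empirical_df X n w).
Proof.
move=> x; rewrite [X in _ --> X]empirical_dfE.
apply: (@cvg_empirical_df _ _ _ _ (fun i : 'I_n => X i w <= x)) => i.
case: (leP (X i w) x) => Xx; near=> y.
  by apply: (le_trans Xx); near: y; exact: nbhs_right_ge.
by apply/negbTE; rewrite -ltNge; near: y; exact: nbhs_right_lt.
Unshelve. all: by end_near. Qed.

HB.instance Definition _ n w := isCumulative.Build R _ R (empirical_df X n w)
  (empirical_df_nondecreasing n w) (empirical_df_right_continuous n w).

Lemma empirical_dfNy n w : empirical_df X n.+1 w @ -oo --> (0 : R).
Proof.
have -> : 0 = n.+1%:R^-1 * \sum_(i < n.+1) false%:R :> R by rewrite big1// mulr0.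
apply: (@cvg_empirical_df _ _ _ _ (fun=> false)) => i.
near=> y; apply/negbTE; rewrite -ltNge; near: y; exact/nbhs_ninfty_lt/num_real.
Unshelve. all: by end_near. Qed.

Lemma empirical_dfy n w : empirical_df X n.+1 w @ +oo --> (1 : R).
Proof.
have -> : 1 = n.+1%:R^-1 * \sum_(i < n.+1) true%:R :> R.
  by rewrite sumr_const card_ord mulVf.
apply: (@cvg_empirical_df _ _ _ _ (fun=> true)) => i.
exact/nbhs_pinfty_ge/num_real.
Unshelve. all: by end_near. Qed.

HB.instance Definition _ n w := isCumulativeBounded.Build R 0 1
  (empirical_df X n.+1 w) (empirical_dfNy n w) (empirical_dfy n w).

(** A countable union over grid tuples of knots; for fixed knots, r_{F_n,F}
    depends on finitely many values of F_n. *)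
Lemma measurable_Dq_gt (F : cumulativeBounded (0 : R) 1) q n (eps : R) :
  measurable [set w | eps < Dq q (empirical_df X n.+1 w) F].
Proof.
pose v (Nt : nat * q.-tuple int) : q.-tuple R :=
  map_tuple (grid_point Nt.1) Nt.2.
have -> : [set w | eps < Dq q (empirical_df X n.+1 w) F] =
    \bigcup_Nt [set w | sorted <=%R (v Nt) /\
                       rFG (empirical_df X n.+1 w) F (v Nt) < 1 - eps].
  apply/seteqP; split=> w /=.
    by move=> /(@Dq_gtP _ (empirical_df X n.+1 w))[Nt HNt]; exists Nt.
  move=> [Nt _ HNt]; by apply/(@Dq_gtP _ (empirical_df X n.+1 w)); exists Nt.
apply: countable_bigcupT_measurable => // Nt.
have [sv|nsv] := boolP (sorted <=%R (v Nt)); last first.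
  by rewrite (_ : [set _ | _] = set0)//; apply/seteqP; split => // w [].
rewrite (_ : [set _ | _] = [set w | rFG (empirical_df X n.+1 w) F (v Nt) < 1 - eps]);
  last by apply/seteqP; split => w //= [].
have mE y : measurable_fun setT
    (fun w => ext_value (empirical_df X n.+1 w) y : R).
  case: y => [r||].
  - apply: measurable_funM => //; apply: measurable_sum => j.
    by apply: measurableT_comp => //; exact: measurable_indic.
  - rewrite (_ : (fun _ => _) = cst 1)//.
    by apply/funext => w; exact: (@ext_valuey _ (empirical_df X n.+1 w)).
  - rewrite (_ : (fun _ => _) = cst 0)//.
    by apply/funext => w; exact: (@ext_valueNy _ (empirical_df X n.+1 w)).
have mr : measurable_fun setT (fun w => rFG (empirical_df X n.+1 w) F (v Nt)).
  by apply: measurable_sum => i; apply: measurable_minr; exact: measurable_funB.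
rewrite (_ : [set _ | _] =
    setT `&` (fun w => rFG (empirical_df X n.+1 w) F (v Nt)) @^-1` `]-oo, 1 - eps[).
  exact: mr.
by rewrite setTI; apply/seteqP; split => w /=; rewrite in_itv.
Qed.

End EmpiricalDF.

(** * Half-lines at a level of a distribution function *)
Section LevelSets.
Context {R : realType} (F : cumulativeBounded (0 : R) 1).

(** This is {F < c}, written as a union of the half-lines whose measure F
    gives. *)
Definition below_level (c : R) : set R := \bigcup_(x in [set x | F x < c]) `]-oo, x]%classic.

(** For 0 < c < 1 this is {F >= c} without its least point, the c-quantile of F,
    at which F may have a jump. *)
Definition above_level (c : R) : set R := \bigcup_(x in [set x | c <= F x]) `]x, +oo[%classic.

(** An enumeration of the rationals, with default value 0 at the indices that
    encode none. *)
Definition rat_point (i : nat) : R := ratr (odflt 0 (choice.unpickle i : option rat)).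

Lemma rat_point_dense (x y : R) : x < y -> exists i, x < rat_point i < y.
Proof.
move=> /rat_in_itvoo[r]; rewrite in_itv/= => xry.
by exists (choice.pickle r); rewrite /rat_point choice.pickleK.
Qed.

(** By right-continuity, F stays below c on a little to the right of x, where
    there is a rational. *)
Lemma below_levelE c : below_level c =
  \bigcup_i (if F (rat_point i) < c then `]-oo, rat_point i]%classic else set0).
Proof.
apply/seteqP; split=> y [].
  move=> x /= Fx; rewrite in_itv/= => yx.
  have /cvgr_lt /(_ _ Fx) := @cumulative_is_right_continuous _ _ _ F x.
  move=> [e /= e0 Fe].
  have [i /andP[xi ie]] : exists i, x < rat_point i < x + e.
    by apply: rat_point_dense; rewrite ltrDl.
  exists i => //; rewrite ifT; first by rewrite /= in_itv/= (le_trans yx)// ltW.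
  by apply: Fe => //=; rewrite distrC gtr0_norm ?subr_gt0//; lra.
by move=> i _; case: ifPn => // Fi yi; exists (rat_point i).
Qed.

Lemma above_levelE c : above_level c =
  \bigcup_i (if c <= F (rat_point i) then `]rat_point i, +oo[%classic else set0).
Proof.
apply/seteqP; split=> y [].
  move=> x /= Fx; rewrite in_itv/= andbT => /rat_point_dense[i /andP[xi iy]].
  exists i => //; rewrite ifT; first by rewrite /= in_itv/= iy.
  by rewrite (le_trans Fx)//; apply: cumulative_is_nondecreasing; exact: ltW.
by move=> i _; case: ifPn => // Fi yi; exists (rat_point i).
Qed.

Lemma measurable_below_level c : measurable (below_level c).
Proof. by rewrite below_levelE; apply: bigcupT_measurable => i; case: ifP. Qed.

Lemma measurable_above_level c : measurable (above_level c).
Proof. by rewrite above_levelE; apply: bigcupT_measurable => i; case: ifP. Qed.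

Context d (T : measurableType d) (P : probability T R) (Y : {RV P >-> R}).
Context (Y_cdf : forall x, cdf Y x = (F x)%:E).

(** The half-lines ]-oo, r] with F r < c form a chain and have measure F r. *)
Lemma probability_below_level c : 0 <= c ->
  (P (Y @^-1` below_level c) <= c%:E)%E.
Proof.
move=> c0; rewrite -[P _]/(distribution P Y (below_level c)) below_levelE.
apply: measure_bigcup_chain => // i; first by case: ifP.
- move=> j; case: ifP => _; last by left; exact: sub0set.
  case: ifP => _; last by right; exact: sub0set.
  by have [ij|/ltW ij] := leP (rat_point i) (rat_point j); [left|right];
    apply: subset_itvl; rewrite bnd_simp.
- case: ifPn => [Fi|_]; last by rewrite measure0.
  apply: (@le_trans _ _ (cdf Y (rat_point i))); first exact: lexx.
  by rewrite Y_cdf lee_fin ltW.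
Qed.

Lemma probability_above_level c : c <= 1 ->
  (P (Y @^-1` above_level c) <= (1 - c)%:E)%E.
Proof.
move=> c1; rewrite -[P _]/(distribution P Y (above_level c)) above_levelE.
apply: measure_bigcup_chain => // [i|i j||i]; first by case: ifP.
- case: ifP => _; last by left; exact: sub0set.
  case: ifP => _; last by right; exact: sub0set.
  by have [ij|/ltW ij] := leP (rat_point i) (rat_point j); [right|left];
    apply: subset_itvr; rewrite bnd_simp.
- by rewrite lee_fin subr_ge0.
- case: ifPn => [Fi|_]; last by rewrite measure0 lee_fin subr_ge0.
  apply: (@le_trans _ _ (ccdf Y (rat_point i))); first exact: lexx.
  by rewrite ccdf_1_cdf Y_cdf -EFinB lee_fin lerD2l lerN2.
Qed.

End LevelSets.

(** * Uniform closeness from finitely many events *)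
Section Uniform.
Context d (T : measurableType d) (R : realType) (P : probability T R).
Context (X : nat -> {RV P >-> R}) (F : cumulativeBounded (0 : R) 1).

(** Given x, take for k the integer part of (M + 1) F x.  The sample frequency
    of ]-oo, x] is at most that of the larger set [below_level] at the upper end
    of the cell containing F x, and that of ]x, +oo[ is at most that of
    [above_level] at its lower end. *)
Lemma empirical_df_uniform_close n w (M : nat) (delta : R) :
  (forall k : 'I_M.+2, \sum_(i < n.+1) \1_(below_level F (k.+1%:R / M.+1%:R)) (X i w) <
     n.+1%:R * (k.+1%:R / M.+1%:R + delta)) ->
  (forall k : 'I_M.+2, \sum_(i < n.+1) \1_(above_level F (k%:R / M.+1%:R)) (X i w) <
     n.+1%:R * (1 - k%:R / M.+1%:R + delta)) ->
  forall x, `|empirical_df X n.+1 w x - F x| <= M.+1%:R^-1 + delta.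
Proof.
move=> below above x.
have /andP[F0 F1] := cumulative_itv01 F x.
have FM0 : 0 <= F x * M.+1%:R by rewrite mulr_ge0.
have /andP[kle ltk] := truncn_itv FM0.
have kM : (Num.truncn (F x * M.+1%:R) < M.+2)%N.
  rewrite -(ltr_nat R) (le_lt_trans kle)// (@le_lt_trans _ _ M.+1%:R)//.
    by rewrite ler_piMl.
  by rewrite ltr_nat.
move: (Num.truncn _) kle ltk kM => k kle ltk kM.
have := below (Ordinal kM); have := above (Ordinal kM).
set c := k%:R / M.+1%:R; have -> : k.+1%:R / M.+1%:R = c + M.+1%:R^-1.
  by rewrite /c -natr1 mulrDl mul1r.
have cF : c <= F x by rewrite ler_pdivrMr.
have Fc : F x < c + M.+1%:R^-1.
  by rewrite /c -[X in _ + X]mul1r -mulrDl natr1 ltr_pdivlMr.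
set N := n.+1%:R; have N0 : 0 < N by [].
set S := \sum_(i < n.+1) (X i w <= x)%R%:R : R.
have SE : empirical_df X n.+1 w x = S / N by rewrite empirical_dfE mulrC.
move=> above_k below_k.
have Sbelow : S <= \sum_(i < n.+1) \1_(below_level F (c + M.+1%:R^-1)) (X i w).
  apply: ler_sum => i _; case: (leP (X i w) x) => Xx; last by rewrite indicE.
  by rewrite indicE mem_set//; exists x => //=; rewrite in_itv.
have Sabove : N - S <= \sum_(i < n.+1) \1_(above_level F c) (X i w).
  have -> : N = \sum_(i < n.+1) 1 by rewrite sumr_const card_ord.
  rewrite /S -sumrB; apply: ler_sum => i _.
  case: (leP (X i w) x) => Xx; first by rewrite subrr indicE.
  by rewrite subr0 indicE mem_set//; exists x => //=; rewrite in_itv/= andbT.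
have up := le_lt_trans Sbelow below_k.
have lo := le_lt_trans Sabove above_k.
have NcF : N * c <= N * F x by rewrite ler_pM2l.
have NFc : N * F x < N * (c + M.+1%:R^-1) by rewrite ltr_pM2l.
move: NFc up lo NcF; rewrite SE; move: (M.+1%:R^-1 : R) => m NFc up lo NcF.
rewrite ler_norml lerBrDr ler_pdivlMr// lerBlDr ler_pdivrMr//.
by apply/andP; split; nra.
Qed.

End Uniform.

(** * Complete convergence *)
Lemma geometric_bound_nneseries_lty (R : realType) (u : nat -> \bar R) (C rho : R) :
  0 <= C -> 0 < rho -> rho < 1 ->
  (forall n, (1 <= n)%N -> (0 <= u n)%E /\ (u n <= (C * rho ^+ n)%:E)%E) ->
  (\sum_(1 <= n <oo) u n < +oo)%E.
Proof.
move=> C0 r0 r1 u_le; apply: (@le_lt_trans _ _ (C * (1 - rho)^-1)%:E); last exact: ltry.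
apply: lime_le.
  by apply: is_cvg_nneseries => n n1 _; have [] := u_le n n1.
apply: nearW => n.
apply: (@le_trans _ _ (series (geometric C rho) n)%:E); last first.
  by rewrite lee_fin geometric_le_lim// gtr0_norm.
apply: (@le_trans _ _ (\sum_(1 <= i < n) (C * rho ^+ i)%:E)%E).
  by rewrite !big_nat; apply: lee_sum => i /andP[i1 _]; have [] := u_le i i1.
rewrite sumEFin lee_fin /series/=; case: n => [|n]; first by rewrite !big_geq.
by rewrite [leRHS]big_ltn// lerDr expr0 mulr1.
Qed.

Theorem theorem2p3 (R : realType) (F : cumulativeBounded (0 : R) (1 : R))
    (d : measure_display) (T : measurableType d) (P : probability T R)
    (X : nat -> {RV P >-> R})
    (X_indep : mutually_independent X)
    (X_ident : identically_distributed X)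
    (X_cdf : forall (i : nat) (x : R), cdf (X i) x = (F x)%:E)
    (q : nat) (hq : (1 <= q)%N) (eps : R) (heps : 0 < eps) :
  (forall n : nat, (1 <= n)%N ->
     measurable [set w : T | eps < Dq q (empirical_df X n w) F]) /\
  (\sum_(1 <= n <oo) P [set w : T | (eps < Dq q (empirical_df X n w) F)%R]
     < +oo)%E.
Proof.
split=> [[//|n] _|]; first exact: measurable_Dq_gt.
pose eta := eps / (2 * q.+1%:R).
have eta0 : 0 < eta by rewrite divr_gt0// mulr_gt0.
pose delta := Num.min 1 (eta / 2).
have d0 : 0 < delta by rewrite lt_min ltr01 divr_gt0.
have d1 : delta <= 1 by rewrite ge_min lexx.
have deta : delta <= eta / 2 by rewrite ge_min lexx orbT.
have [M Meta] : exists M : nat, M.+1%:R^-1 < eta / 2.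
  have /cvgr_lt/(_ (eta / 2)) := @cvg_harmonic R.
  by rewrite divr_gt0// => /(_ isT)/filter_ex.
(* (k, true): too many observations below level (k + 1) / (M + 1);
   (k, false): too many above level k / (M + 1).  The index k = M + 1 is
   needed for the points where F = 1. *)
pose bad n (kb : 'I_M.+2 * bool) : set T :=
  let p := if kb.2 then kb.1.+1%:R / M.+1%:R else 1 - kb.1%:R / M.+1%:R in
  let A := if kb.2 then below_level F (kb.1.+1%:R / M.+1%:R)
           else above_level F (kb.1%:R / M.+1%:R) in
  [set w | n%:R * (p + delta) <= \sum_(i < n) \1_A (X i w)].
pose rho := expR (- (delta ^+ 2 / 8)).
have rho1 : rho < 1 by rewrite expR_lt1 oppr_lt0 divr_gt0// exprn_gt0.
have mA (kb : 'I_M.+2 * bool) :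
    measurable (if kb.2 then below_level F (kb.1.+1%:R / M.+1%:R)
                else above_level F (kb.1%:R / M.+1%:R)).
  by case: ifP => _; [exact: measurable_below_level|exact: measurable_above_level].
have mbad n kb : measurable (bad n kb).
  rewrite -[X in measurable X]setTI; apply: measurable_fun_le => //.
  by apply: measurable_sum => i; apply: measurableT_comp => //; exact: measurable_indic.
have Pbad n kb : (P (bad n kb) <= (rho ^+ n)%:E)%E.
  apply: chernoff_independent_count => // i.
  case: kb => k [] /=; first exact: probability_below_level.
  apply: probability_above_level => //.
  by rewrite ler_pdivrMr// mul1r ler_nat -ltnS.
have bad_cover n : [set w | eps < Dq q (empirical_df X n.+1 w) F] `<=`
    \big[setU/set0]_kb bad n.+1 kb.
  move=> w /= Dw; rewrite -bigcup_seq; apply: contrapT => nbad; move: Dw.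
  apply/negP; rewrite -leNgt.
  have good kb : ~ bad n.+1 kb w.
    by move=> bw; apply: nbad; exists kb => //=; exact: mem_index_enum.
  apply: (@le_trans _ _ (q.+1%:R * (2 * eta))).
    apply: (@Dq_le_uniform _ F (empirical_df X n.+1 w)) => x.
    apply: (@le_trans _ _ (M.+1%:R^-1 + delta)); last first.
      by rewrite [leRHS](splitr eta) lerD// ltW.
    apply: empirical_df_uniform_close => k; rewrite ltNge; apply/negP.
      exact: (good (k, true)).
    exact: (good (k, false)).
  by rewrite /eta; move: (q.+1%:R : R) (ltr0Sn R q) => Q Q0; rewrite le_eqVlt;
    apply/orP; left; apply/eqP; field; rewrite gt_eqF.
apply: (@geometric_bound_nneseries_lty _ _ #|{: 'I_M.+2 * bool}|%:R rho) => //.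
  exact: expR_gt0.
move=> [//|n] _; split; first exact: measure_ge0.
apply: le_trans.
  apply: le_measure (bad_cover n); rewrite inE; first exact: measurable_Dq_gt.
  by elim/big_ind: _ => // *; exact: measurableU.
apply: le_trans; first exact: measure_bigsetU_le.
apply: (@le_trans _ _ (\sum_(kb : 'I_M.+2 * bool) (rho ^+ n.+1)%:E)%E).
  by apply: lee_sum => kb _; exact: Pbad.
by rewrite sumEFin lee_fin sumr_const mulr_natl.
Qed.
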